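(* Let $K$ be a perfect field and $R$ an integral domain which is a finitely generated $K$-algebra or a localisation of one. Up to isomorphism, there exists a unique $R$-cga $\hat\Omega_{R/K}$ together with a higher derivation $d_R:R\to\hat\Omega_{R/K}$ over $K$ with the following universal property: for each homomorphism of $K$-algebras $f:R\to\tilde R$ into an integral domain $\tilde R$ which is a finitely generated $K$-algebra or a localisation of one, each $\tilde R$-cga $B$ and each higher derivation $\psi:R\to B$ over $K$ (relative to $f$), there exists a unique homomorphism of $\tilde R$-cgas $\tilde\psi:\tilde R\otimes_R\hat\Omega_{R/K}\to B$ with $\tilde\psi\circ(1\otimes d_R)=\psi$. In other words, $\hat\Omega_{R/K}$ represents the functor $\mathrm{HD}_K(R,-)$.
   Context: For a commutative ring $S$, an $S$-cga is a commutative ring $B$ that is the completion of a graded commutative $S$-algebra $\bigoplus_{i\ge0}B_i$ with $B_0=S$, with respect to the filtration by the ideals $\bigoplus_{i\ge k}B_i$; thus $B=\prod_{i\ge0}B_i$ as an $S$-module. The augmentation $\varepsilon:B\to B_0=S$ is the projection. A homomorphism of $S$-cgas is the continuous map induced by a homomorphism of the underlying graded $S$-algebras. For an $R$-cga $B$ and an $R$-algebra $\tilde R$, $\tilde R\otimes_RB$ denotes the $\tilde R$-cga with homogeneous components $\tilde R\otimes_RB_k$. Given a $K$-algebra homomorphism $f:R\to\tilde R$ and an $\tilde R$-cga $B$, a higher derivation of $R$ to $B$ over $K$ is a $K$-algebra homomorphism $\psi:R\to B$ with $\varepsilon\circ\psi=f$; the set of these is $\mathrm{HD}_K(R,B)$.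 *)

(* Defs.v *)
From HB Require Import structures.
From mathcomp Require Import all_boot all_order all_algebra separable.
From mathcomp Require Import boolp.

Set Implicit Arguments.
Unset Strict Implicit.
Unset Printing Implicit Defensive.

Import GRing.Theory.
Local Open Scope ring_scope.
Local Open Scope quotient_scope.

Definition perfect_field (K : fieldType) : Prop :=
  forall p : {poly K}, irreducible_poly p -> separable_poly p.

Definition finitely_generated (K : fieldType) (A : comAlgType K) : Prop :=
  exists s : seq A, forall P : {pred A},
    GRing.subalg_closed P -> {subset s <= P} -> forall a, a \in P.

(* l exhibits L as the localisation of A at the multiplicative set T. *)
Definition is_localisation (K : fieldType) (A L : comAlgType K)
    (T : {pred A}) (l : {lrmorphism A -> L}) : Prop :=
  [/\ GRing.mulr_closed T,
      {in T, forall t, exists u, l t * u = 1},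
      (forall x : L, exists a t, t \in T /\ x * l t = l a)
    & (forall a : A, l a = 0 -> exists2 t, t \in T & t * a = 0)].

Definition fg_or_localisation (K : fieldType) (L : comAlgType K) : Prop :=
  finitely_generated L \/
  exists (A : comAlgType K) (T : {pred A}) (l : {lrmorphism A -> L}),
    finitely_generated A /\ is_localisation T l.

(* A = \bigoplus_i A_i (internal direct sum), with S -> A_0 bijective.  The   *)
(* ring is commutative in the ordinary sense (no Koszul signs).               *)
Record gradedAlg (S : comNzRingType) := GradedAlg {
  gcarrier :> comAlgType S;
  gdeg : nat -> {pred gcarrier};
  gdeg_submod : forall i, GRing.submod_closed (gdeg i);
  gdeg_mul : forall i j x y,
    x \in gdeg i -> y \in gdeg j -> x * y \in gdeg (i + j)%N;
  gdeg_span : forall x : gcarrier, exists n (a : nat -> gcarrier),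
    (forall i, a i \in gdeg i) /\ x = \sum_(i < n) a i;
  gdeg_free : forall n (a : nat -> gcarrier),
    (forall i, a i \in gdeg i) -> \sum_(i < n) a i = 0 ->
    forall i, (i < n)%N -> a i = 0;
  gdeg0_inj : injective (fun s : S => s%:A : gcarrier);
  gdeg0P : forall x, x \in gdeg 0 <-> exists s : S, x = s%:A }.

Arguments gdeg {S} A i : rename.

Section Graded.
Variables (S : comNzRingType) (A : gradedAlg S).
Implicit Types x y : A.

Lemma gdeg0r i : (0 : A) \in gdeg A i.
Proof. by case: (gdeg_submod A i). Qed.

Lemma gdegZD i (c : S) x y :
  x \in gdeg A i -> y \in gdeg A i -> c *: x + y \in gdeg A i.
Proof. by move=> xi yi; case: (gdeg_submod A i) => _; apply. Qed.

Lemma gdegD i x y : x \in gdeg A i -> y \in gdeg A i -> x + y \in gdeg A i.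
Proof. by move=> xi yi; rewrite -[x]scale1r gdegZD. Qed.

Lemma gdegZ i (c : S) x : x \in gdeg A i -> c *: x \in gdeg A i.
Proof. by move=> xi; rewrite -[_ *: _]addr0 gdegZD // gdeg0r. Qed.

Lemma gdegN i x : x \in gdeg A i -> - x \in gdeg A i.
Proof. by rewrite -scaleN1r; apply: gdegZ. Qed.

Lemma gdeg_sum i (I : Type) (r : seq I) (P : pred I) (F : I -> A) :
  (forall j, P j -> F j \in gdeg A i) -> \sum_(j <- r | P j) F j \in gdeg A i.
Proof.
move=> H; elim/big_ind: _ => [|x y|j /H] //; [exact: gdeg0r | exact: gdegD].
Qed.

Lemma gdeg1 : (1 : A) \in gdeg A 0.
Proof. by apply/gdeg0P; exists 1; rewrite scale1r. Qed.

(* The homogeneous components of an element. *)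
Lemma gcomp_ex x : exists p : nat * (nat -> A),
  (forall i, p.2 i \in gdeg A i) /\ x = \sum_(i < p.1) p.2 i.
Proof. by case: (gdeg_span x) => n [a H]; exists (n, a). Qed.

Definition gcomp k x : A :=
  let p := sval (cid (gcomp_ex x)) in if (k < p.1)%N then p.2 k else 0.

Lemma gcompE n (a : nat -> A) k : (forall i, a i \in gdeg A i) ->
  gcomp k (\sum_(i < n) a i) = if (k < n)%N then a k else 0.
Proof.
move=> ain; rewrite /gcomp; case: cid => -[m b] /= [bin eqab].
pose N := maxn (maxn m n) k.+1.
have ext l (c : nat -> A) : (l <= N)%N ->
    \sum_(i < l) c i = \sum_(i < N) (if (i < l)%N then c i else 0).
  by move=> leN; rewrite (big_ord_widen _ _ leN) big_mkcond.
pose d i := (if (i < m)%N then b i else 0) - (if (i < n)%N then a i else 0).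
have din i : d i \in gdeg A i.
  by apply: gdegD; [|apply: gdegN]; case: ifP => _ //; apply: gdeg0r.
have d0 : \sum_(i < N) d i = 0.
  rewrite big_split /= sumrN -ext; last by rewrite /N !leq_max leqnn.
  rewrite -ext; last by rewrite /N !leq_max leqnn orbT.
  by rewrite -eqab subrr.
have dk : d k = 0.
  by apply: (gdeg_free din d0); rewrite /N leq_max leqnn orbT.
by apply/eqP; rewrite -subr_eq0 -/(d k) dk.
Qed.

Lemma gcomp_deg k x : gcomp k x \in gdeg A k.
Proof.
rewrite /gcomp; case: cid => -[n a] /= [ain _].
by case: ifP => _ //; apply: gdeg0r.
Qed.

Lemma gcomp_sum x : exists n, x = \sum_(i < n) gcomp i x.
Proof.
have [n [a [ain ->]]] := gdeg_span x; exists n.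
by apply: eq_bigr => i _; rewrite gcompE // ltn_ord.
Qed.

Lemma gcomp_id i k x : x \in gdeg A i -> gcomp k x = if k == i then x else 0.
Proof.
move=> xi; pose a j := if j == i then x else 0.
have ain j : a j \in gdeg A j.
  by rewrite /a; case: eqP => [->|_] //; apply: gdeg0r.
have {1}-> : x = \sum_(j < (maxn i k).+1) a j.
  have ilt : (i < (maxn i k).+1)%N by rewrite ltnS leq_maxl.
  rewrite (bigD1 (Ordinal ilt)) //= {1}/a eqxx big1 ?addr0 // => j.
  by rewrite -val_eqE /a /= => /negPf ->.
by rewrite gcompE // ltnS leq_maxr.
Qed.

Lemma gcompZD k (c : S) x y : gcomp k (c *: x + y) = c *: gcomp k x + gcomp k y.
Proof.
have [n [a [ain ->]]] := gdeg_span x; have [m [b [bin ->]]] := gdeg_span y.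
pose N := maxn m n.
have ext l (e : nat -> A) : (l <= N)%N ->
    \sum_(i < l) e i = \sum_(i < N) (if (i < l)%N then e i else 0).
  by move=> leN; rewrite (big_ord_widen _ _ leN) big_mkcond.
pose d i := c *: (if (i < n)%N then a i else 0) + (if (i < m)%N then b i else 0).
have -> : c *: \sum_(i < n) a i + \sum_(i < m) b i = \sum_(i < N) d i.
  rewrite big_split /= -scaler_sumr -!ext // /N leq_max leqnn ?orbT //.
rewrite !gcompE //; last first.
  by move=> i; apply: gdegZD; case: ifP => _ //; apply: gdeg0r.
case: ifP => // /negbT; rewrite -leqNgt geq_max => /andP[mk nk].
by rewrite !ltnNge mk nk scaler0 addr0.
Qed.

Lemma gcompD k x y : gcomp k (x + y) = gcomp k x + gcomp k y.
Proof. by rewrite -[x in LHS]scale1r gcompZD scale1r. Qed.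

Lemma gcomp0 k : gcomp k 0 = 0.
Proof. by rewrite (@gcomp_id k) ?eqxx // gdeg0r. Qed.

Lemma gcompZ k (c : S) x : gcomp k (c *: x) = c *: gcomp k x.
Proof. by rewrite -[_ *: x]addr0 gcompZD gcomp0 addr0. Qed.

Lemma gaug_ex x : exists s : S, gcomp 0 x = s%:A.
Proof. by apply/gdeg0P; apply: gcomp_deg. Qed.

(* The projection of the graded algebra onto A_0 = S. *)
Definition gaug x : S := sval (cid (gaug_ex x)).

Lemma gaugE x : (gaug x)%:A = gcomp 0 x.
Proof. by rewrite /gaug; case: cid. Qed.

Lemma gaugD x y : gaug (x + y) = gaug x + gaug y.
Proof. by apply: (@gdeg0_inj _ A); rewrite /= scalerDl !gaugE gcompD. Qed.

Lemma gaugZ (c : S) x : gaug (c *: x) = c * gaug x.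
Proof. by apply: (@gdeg0_inj _ A); rewrite /= -scalerA !gaugE gcompZ. Qed.

Lemma gaug1 : gaug 1 = 1.
Proof.
by apply: (@gdeg0_inj _ A); rewrite /= gaugE scale1r (@gcomp_id 0) // gdeg1.
Qed.

End Graded.

(* The S-cga which is the completion \prod_i A_i of A = \bigoplus_i A_i: its  *)
(* elements are the sequences of homogeneous components, its product is the   *)
(* Cauchy product.                                                            *)
Record completion (S : comNzRingType) (A : gradedAlg S) := Completion {
  ccoef :> nat -> A;
  ccoefP : forall i, ccoef i \in gdeg A i }.

Section Completion.
Variables (S : comNzRingType) (A : gradedAlg S).
Local Notation B := (completion A).
Implicit Types b c d : B.

Lemma completion_eq b c : (forall i, b i = c i) -> b = c.
Proof.
case: b c => [b bP] [c cP] /= /funext ebc; case: _ / ebc in cP *.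
by congr Completion; apply: Prop_irrelevance.
Qed.

HB.instance Definition _ := gen_eqMixin B.
HB.instance Definition _ := gen_choiceMixin B.

Definition czero : B := Completion (@gdeg0r S A).
Definition cadd b c : B :=
  Completion (fun i => gdegD (ccoefP b i) (ccoefP c i)).
Definition copp b : B := Completion (fun i => gdegN (ccoefP b i)).

Lemma cone_subproof i : (if i == 0%N then 1 else 0 : A) \in gdeg A i.
Proof. by case: eqP => [->|_]; [apply: gdeg1 | apply: gdeg0r]. Qed.
Definition cone : B := Completion cone_subproof.

Lemma cmul_subproof b c n : \sum_(i < n.+1) b i * c (n - i)%N \in gdeg A n.
Proof.
apply: gdeg_sum => i _.
have := gdeg_mul (ccoefP b i) (ccoefP c (n - i)).
by rewrite subnKC // -ltnS.
Qed.
Definition cmul b c : B := Completion (cmul_subproof b c).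

Definition cscale (s : S) b : B := Completion (fun i => gdegZ s (ccoefP b i)).

Fact caddA : associative cadd.
Proof. by move=> b c d; apply: completion_eq => i /=; rewrite addrA. Qed.
Fact caddC : commutative cadd.
Proof. by move=> b c; apply: completion_eq => i /=; rewrite addrC. Qed.
Fact cadd0 : left_id czero cadd.
Proof. by move=> b; apply: completion_eq => i /=; rewrite add0r. Qed.
Fact caddN : left_inverse czero copp cadd.
Proof. by move=> b; apply: completion_eq => i /=; rewrite addNr. Qed.

HB.instance Definition _ := GRing.isZmodule.Build B caddA caddC cadd0 caddN.

Let trunc n b : {poly A} := \poly_(i < n.+1) b i.

Let coef_truncM n b c k : (k <= n)%N -> (trunc n b * trunc n c)`_k = cmul b c k.
Proof.
move=> kn; rewrite coefM; apply: eq_bigr => i _.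
by rewrite !coef_poly !ltnS (leq_trans _ kn) ?(leq_trans (leq_subr _ _) kn) // -ltnS.
Qed.

Fact cmulA : associative cmul.
Proof.
move=> b c d; apply: completion_eq => n.
transitivity ((trunc n b * (trunc n c * trunc n d))`_n).
  rewrite coefM; apply: eq_bigr => i _.
  by rewrite coef_poly ltn_ord coef_truncM // leq_subr.
rewrite mulrA coefM; apply: eq_bigr => i _.
by rewrite coef_truncM -1?ltnS // coef_poly ltnS leq_subr.
Qed.

Fact cmulC : commutative cmul.
Proof.
move=> b c; apply: completion_eq => n.
by rewrite -!(@coef_truncM n) // mulrC.
Qed.

Fact cmul1 : left_id cone cmul.
Proof.
move=> b; apply: completion_eq => n /=.
by rewrite big_ord_recl /= mul1r subn0 big1 ?addr0 // => i _; rewrite mul0r.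
Qed.

Fact cmulDl : left_distributive cmul cadd.
Proof.
move=> b c d; apply: completion_eq => n /=.
by rewrite -big_split; apply: eq_bigr => i _; rewrite mulrDl.
Qed.

Fact cone_neq0 : cone != 0.
Proof.
apply/eqP => /(congr1 (fun b : B => b 0%N)) /= /eqP.
by rewrite oner_eq0.
Qed.

HB.instance Definition _ :=
  GRing.Zmodule_isComNzRing.Build B cmulA cmulC cmul1 cmulDl cone_neq0.

Fact cscaleA r s b : cscale r (cscale s b) = cscale (r * s) b.
Proof. by apply: completion_eq => n /=; rewrite scalerA. Qed.
Fact cscale1 : left_id 1 cscale.
Proof. by move=> b; apply: completion_eq => n /=; rewrite scale1r. Qed.
Fact cscaleDr : right_distributive cscale +%R.
Proof. by move=> s b c; apply: completion_eq => n /=; rewrite scalerDr. Qed.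
Fact cscaleDl b : {morph cscale^~ b : r s / r + s}.
Proof. by move=> r s; apply: completion_eq => n /=; rewrite scalerDl. Qed.

HB.instance Definition _ :=
  GRing.Zmodule_isLmodule.Build S B cscaleA cscale1 cscaleDr cscaleDl.

Fact cscaleAl (s : S) b c : s *: (b * c) = (s *: b) * c.
Proof.
apply: completion_eq => n /=; rewrite scaler_sumr.
by apply: eq_bigr => i _; rewrite scalerAl.
Qed.

HB.instance Definition _ := GRing.Lmodule_isLalgebra.Build S B cscaleAl.
HB.instance Definition _ := GRing.Lalgebra_isComAlgebra.Build S B.

Lemma augmentation_ex b : exists s : S, b 0%N = s%:A.
Proof. by apply/gdeg0P; apply: ccoefP. Qed.

(* The projection onto B_0, read in S through the bijection s |-> s%:A. *)
Definition augmentation b : S := sval (cid (augmentation_ex b)).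

Lemma augmentationE b : (augmentation b)%:A = b 0%N.
Proof. by rewrite /augmentation; case: cid. Qed.

End Completion.

Definition graded_hom (S : comNzRingType) (A A' : gradedAlg S)
    (g : {lrmorphism A -> A'}) : Prop :=
  forall i x, x \in gdeg A i -> g x \in gdeg A' i.

(* The continuous maps induced by homomorphisms of the underlying graded      *)
(* algebras.                                                                  *)
Definition cga_hom (S : comNzRingType) (A A' : gradedAlg S)
    (phi : completion A -> completion A') : Prop :=
  exists g : {lrmorphism A -> A'},
    graded_hom g /\ forall b i, phi b i = g (b i).

Definition cga_iso (S : comNzRingType) (A A' : gradedAlg S)
    (phi : completion A -> completion A') : Prop :=
  cga_hom phi /\
  exists psi, [/\ cga_hom psi, cancel phi psi & cancel psi phi].

(* The tensor product S (x)_R A along f : R -> S.  A sequence of pairs (a, x) *)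
(* stands for the formal sum of the a (x) x.                                  *)
Section Tensor.
Variables (R S : comNzRingType) (f : {rmorphism R -> S}) (A : gradedAlg R).
Implicit Types s : seq (S * A).

Inductive tens_eq : seq (S * A) -> seq (S * A) -> Prop :=
| tens_refl s : tens_eq s s
| tens_sym s s' : tens_eq s s' -> tens_eq s' s
| tens_trans s s' s'' : tens_eq s s' -> tens_eq s' s'' -> tens_eq s s''
| tens_cat s1 s1' s2 s2' :
    tens_eq s1 s1' -> tens_eq s2 s2' -> tens_eq (s1 ++ s2) (s1' ++ s2')
| tens_catC s s' : tens_eq (s ++ s') (s' ++ s)
| tens_0l x : tens_eq [:: (0, x)] [::]
| tens_Dl a b x : tens_eq [:: (a + b, x)] [:: (a, x); (b, x)]
| tens_Dr a x y : tens_eq [:: (a, x + y)] [:: (a, x); (a, y)]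
| tens_bal a r x : tens_eq [:: (a * f r, x)] [:: (a, r *: x)].

Definition tens_rel s s' := `[< tens_eq s s' >].

Fact tens_rel_refl : reflexive tens_rel.
Proof. by move=> s; apply/asboolP; apply: tens_refl. Qed.
Fact tens_rel_sym : symmetric tens_rel.
Proof. by move=> s s'; apply/asboolP/asboolP; apply: tens_sym. Qed.
Fact tens_rel_trans : transitive tens_rel.
Proof.
by move=> s s' s'' /asboolP e1 /asboolP e2; apply/asboolP; apply: tens_trans e1 e2.
Qed.

Canonical tens_equiv := EquivRel tens_rel tens_rel_refl tens_rel_sym tens_rel_trans.

Definition tensor := {eq_quot tens_equiv}.
HB.instance Definition _ := Choice.on tensor.
HB.instance Definition _ := EqQuotient.on tensor.

Lemma tens_piP s s' : tens_eq s s' <-> \pi_tensor s = \pi_tensor s'.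
Proof.
split; first by move=> st; apply/eqquotP; apply/asboolP.
by move/eqquotP/asboolP.
Qed.

Lemma tens_reprP s : tens_eq (repr (\pi_tensor s)) s.
Proof. by apply/tens_piP; rewrite reprK. Qed.

Lemma tens_piW (P : tensor -> Prop) :
  (forall s, P (\pi_tensor s)) -> forall x, P x.
Proof. by move=> H x; rewrite -[x]reprK. Qed.

Definition tadd (x y : tensor) : tensor := \pi_tensor (repr x ++ repr y).
Definition tens_neg s : seq (S * A) := [seq (- p.1, p.2) | p <- s].
Definition topp (x : tensor) : tensor := \pi_tensor (tens_neg (repr x)).
Definition tens (a : S) (x : A) : tensor := \pi_tensor [:: (a, x)].

Lemma tadd_pi s s' :
  tadd (\pi_tensor s) (\pi_tensor s') = \pi_tensor (s ++ s').
Proof. by apply/tens_piP; apply: tens_cat; apply: tens_reprP. Qed.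

Fact taddA : associative tadd.
Proof.
elim/tens_piW=> s; elim/tens_piW=> t; elim/tens_piW=> u.
by rewrite !tadd_pi catA.
Qed.
Fact taddC : commutative tadd.
Proof.
elim/tens_piW=> s; elim/tens_piW=> t; rewrite !tadd_pi.
by apply/tens_piP; apply: tens_catC.
Qed.
Fact tadd0 : left_id (\pi_tensor [::]) tadd.
Proof. by elim/tens_piW=> s; rewrite tadd_pi. Qed.
Fact taddN : left_inverse (\pi_tensor [::]) topp tadd.
Proof.
elim/tens_piW=> s; rewrite /topp -{2}[\pi_tensor s]reprK tadd_pi.
elim: (repr _) => //= -[a x] {}s IH.
have -> : (- a, x) :: tens_neg s ++ (a, x) :: s
        = [:: (- a, x)] ++ tens_neg s ++ [:: (a, x)] ++ s by [].
rewrite -!tadd_pi [tadd (\pi_tensor (tens_neg s)) _]taddC -!taddA.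
rewrite [tadd (\pi_tensor s) _]taddC [tadd (\pi_tensor (tens_neg s)) _]tadd_pi IH.
rewrite !tadd_pi; apply/tens_piP.
apply: tens_trans (tens_0l x); apply: tens_sym.
by rewrite -{1}(addNr a); apply: tens_Dl.
Qed.

HB.instance Definition _ := GRing.isZmodule.Build tensor taddA taddC tadd0 taddN.

Lemma tens_pi s : \pi_tensor s = \sum_(p <- s) tens p.1 p.2.
Proof.
elim: s => [|[a x] s IH]; first by rewrite big_nil.
by rewrite big_cons -IH -cat1s -tadd_pi.
Qed.

Lemma tensorP (x : tensor) : exists s : seq (S * A), x = \sum_(p <- s) tens p.1 p.2.
Proof. by elim/tens_piW: x => s; exists s; rewrite tens_pi. Qed.

Implicit Types t u : tensor.

Lemma tensorW (P : tensor -> Prop) :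
  P 0 -> (forall a x t, P t -> P (tens a x + t)) -> forall t, P t.
Proof.
move=> P0 PD t; have [s ->] := tensorP t.
by elim: s => [|p s IH]; rewrite ?big_nil // big_cons; apply: PD.
Qed.

Lemma tensDl a b x : tens (a + b) x = tens a x + tens b x.
Proof. by rewrite [RHS]tadd_pi; apply/tens_piP; apply: tens_Dl. Qed.
Lemma tensDr a x y : tens a (x + y) = tens a x + tens a y.
Proof. by rewrite [RHS]tadd_pi; apply/tens_piP; apply: tens_Dr. Qed.
Lemma tensZ a r x : tens (a * f r) x = tens a (r *: x).
Proof. by apply/tens_piP; apply: tens_bal. Qed.
Lemma tens0l x : tens 0 x = 0.
Proof. by apply/tens_piP; apply: tens_0l. Qed.
Lemma tens0r a : tens a 0 = 0.
Proof. by rewrite -(scale0r 0) -tensZ rmorph0 mulr0 tens0l. Qed.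

Definition balanced (M : zmodType) (phi : S -> A -> M) : Prop :=
  [/\ forall a b x, phi (a + b) x = phi a x + phi b x,
      forall a x y, phi a (x + y) = phi a x + phi a y
    & forall a r x, phi (a * f r) x = phi a (r *: x)].

(* The additive map induced by a balanced map. *)
Definition tens_lift (M : zmodType) (phi : S -> A -> M) (t : tensor) : M :=
  \sum_(p <- repr t) phi p.1 p.2.

Section Lift.
Variables (M : zmodType) (phi : S -> A -> M).
Hypothesis phiP : balanced phi.

Lemma tens_lift_pi s : tens_lift phi (\pi_tensor s) = \sum_(p <- s) phi p.1 p.2.
Proof.
case: phiP => phiDl phiDr phiZ.
have H (u t : seq (S * A)) : tens_eq u t -> \sum_(p <- u) phi p.1 p.2 = \sum_(p <- t) phi p.1 p.2.
  elim=> {u t} //=.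
  - by move=> ? ? ? _ -> _ ->.
  - by move=> ? ? ? ? _ e1 _ e2; rewrite !big_cat /= e1 e2.
  - by move=> ? ?; rewrite !big_cat /= addrC.
  - move=> x; rewrite big_seq1 big_nil /=.
    by apply: (@addrI _ (phi 0 x)); rewrite -phiDl !addr0.
  - by move=> a b x; rewrite !(big_cons, big_nil) /= !addr0 phiDl.
  - by move=> a x y; rewrite !(big_cons, big_nil) /= !addr0 phiDr.
  - by move=> a r x; rewrite !big_seq1 /= phiZ.
exact: H (tens_reprP s).
Qed.

Lemma tens_liftE a x : tens_lift phi (tens a x) = phi a x.
Proof. by rewrite (tens_lift_pi [:: (a, x)]) big_seq1. Qed.

Lemma tens_liftD : {morph tens_lift phi : t u / t + u}.
Proof.
elim/tens_piW=> s; elim/tens_piW=> t.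
by rewrite [_ + _]tadd_pi !tens_lift_pi big_cat.
Qed.

Lemma tens_lift0 : tens_lift phi 0 = 0.
Proof. by rewrite (tens_lift_pi [::]) big_nil. Qed.
End Lift.

(* (a (x) x) (b (x) y) = a b (x) x y *)
Definition tmul (t u : tensor) : tensor :=
  tens_lift (fun a x => tens_lift (fun b y => tens (a * b) (x * y)) u) t.

Let tmul_bal1 a x : balanced (fun b y => tens (a * b) (x * y)).
Proof.
split=> [b c y|b y z|b r y]; first by rewrite mulrDr tensDl.
  by rewrite mulrDr tensDr.
by rewrite mulrA tensZ scalerAr.
Qed.

Let tmul_bal2 u :
  balanced (fun a x => tens_lift (fun b y => tens (a * b) (x * y)) u).
Proof.
split=> [a b x|a x y|a r x]; elim/tens_piW: u => u;
  rewrite !(tens_lift_pi (tmul_bal1 _ _)) -?big_split.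
- by apply: eq_bigr => p _ /=; rewrite mulrDl tensDl.
- by apply: eq_bigr => p _ /=; rewrite mulrDl tensDr.
- by apply: eq_bigr => p _ /=; rewrite mulrAC tensZ scalerAl.
Qed.

Lemma tmul_tens a x b y : tmul (tens a x) (tens b y) = tens (a * b) (x * y).
Proof.
by rewrite /tmul (tens_liftE (tmul_bal2 _)) (tens_liftE (tmul_bal1 _ _)).
Qed.

Lemma tmulDl : left_distributive tmul +%R.
Proof. by move=> t t' u; rewrite /tmul (tens_liftD (tmul_bal2 _)). Qed.

Fact tmulC : commutative tmul.
Proof.
elim/tens_piW=> s; elim/tens_piW=> s'; rewrite /tmul.
rewrite !(tens_lift_pi (tmul_bal2 _)).
under eq_bigr do rewrite (tens_lift_pi (tmul_bal1 _ _)).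
rewrite exchange_big; apply: eq_bigr => p _ /=.
rewrite (tens_lift_pi (tmul_bal1 _ _)); apply: eq_bigr => q _.
by rewrite mulrC [_.2 * _]mulrC.
Qed.

Lemma tmul0 t : tmul 0 t = 0.
Proof. exact: tens_lift0 (tmul_bal2 t). Qed.

Fact tmulA : associative tmul.
Proof.
have tmulDr t u v : tmul t (u + v) = tmul t u + tmul t v.
  by rewrite tmulC tmulDl !(tmulC t).
have tmul0r t : tmul t 0 = 0 by rewrite tmulC tmul0.
move=> t u v.
elim/tensorW: t => [|a x t IHt]; first by rewrite !tmul0.
rewrite !tmulDl IHt; congr (_ + _); move: {t IHt} v.
elim/tensorW: u => [|b y u IHu] v; first by rewrite !(tmul0, tmul0r).
rewrite !(tmulDl, tmulDr) IHu; congr (_ + _) => {u IHu}.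
elim/tensorW: v => [|c z v IHv]; first by rewrite !tmul0r.
by rewrite !tmulDr IHv !tmul_tens !mulrA.
Qed.

Fact tmul1 : left_id (tens 1 1) tmul.
Proof.
elim/tensorW=> [|a x t IH]; first by rewrite tmulC tmul0.
by rewrite tmulC tmulDl !(tmulC _ (tens 1 1)) IH tmul_tens !mul1r.
Qed.

Let taug_bal : balanced (fun a (x : A) => a * f (gaug x)).
Proof.
split=> [a b x|a x y|a r x]; first by rewrite mulrDl.
  by rewrite gaugD rmorphD mulrDr.
by rewrite gaugZ rmorphM mulrA.
Qed.

Definition taug : tensor -> S := tens_lift (fun a (x : A) => a * f (gaug x)).

Lemma taug_tens1 a : taug (tens a 1) = a.
Proof. by rewrite /taug (tens_liftE taug_bal) gaug1 rmorph1 mulr1. Qed.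

Fact tone_neq0 : tens 1 1 != 0.
Proof.
apply/eqP => /(congr1 taug); rewrite taug_tens1 /taug (tens_lift0 taug_bal) => /eqP.
by rewrite oner_eq0.
Qed.

HB.instance Definition _ :=
  GRing.Zmodule_isComNzRing.Build tensor tmulA tmulC tmul1 tmulDl tone_neq0.

Lemma tensM a x b y : tens a x * tens b y = tens (a * b) (x * y).
Proof. exact: tmul_tens. Qed.

Definition tscale (a : S) (t : tensor) : tensor := tens a 1 * t.

Fact tscaleA a b t : tscale a (tscale b t) = tscale (a * b) t.
Proof. by rewrite /tscale mulrA tensM mulr1. Qed.
Fact tscale1 : left_id 1 tscale.
Proof. exact: mul1r. Qed.
Fact tscaleDr : right_distributive tscale +%R.
Proof. by move=> a t u; rewrite /tscale mulrDr. Qed.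
Fact tscaleDl t : {morph tscale^~ t : a b / a + b}.
Proof. by move=> a b; rewrite /tscale tensDl mulrDl. Qed.

HB.instance Definition _ :=
  GRing.Zmodule_isLmodule.Build S tensor tscaleA tscale1 tscaleDr tscaleDl.

Fact tscaleAl (a : S) (t u : tensor) : a *: (t * u) = (a *: t) * u.
Proof. exact: mulrA. Qed.

HB.instance Definition _ := GRing.Lmodule_isLalgebra.Build S tensor tscaleAl.
HB.instance Definition _ := GRing.Lalgebra_isComAlgebra.Build S tensor.

Lemma scale_tens (a b : S) x : a *: tens b x = tens (a * b) x.
Proof. by rewrite [LHS]tensM mul1r. Qed.

Lemma alg_tens (a : S) : a%:A = tens a 1 :> tensor.
Proof. by rewrite scale_tens mulr1. Qed.

(* The image of S (x)_R A_i.  As A_i is a direct summand of A, the map        *)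
(* S (x)_R A_i -> S (x)_R A is injective.                                     *)
Definition tdeg i : {pred tensor} := fun t =>
  `[< exists s : seq (S * A), all (fun p => p.2 \in gdeg A i) s /\
      t = \sum_(p <- s) tens p.1 p.2 >].

Lemma tdegP i (t : tensor) : reflect
  (exists s : seq (S * A), all (fun p => p.2 \in gdeg A i) s /\
      t = \sum_(p <- s) tens p.1 p.2) (t \in tdeg i).
Proof. exact: asboolP. Qed.

Lemma tdeg_tens i a x : x \in gdeg A i -> tens a x \in tdeg i.
Proof.
by move=> xi; apply/tdegP; exists [:: (a, x)]; rewrite /= xi big_seq1.
Qed.

Fact tdeg_submod i : GRing.submod_closed (tdeg i).
Proof.
split; first by apply/tdegP; exists [::]; rewrite big_nil.
move=> a _ _ /tdegP[s [si ->]] /tdegP[t [ti ->]]; apply/tdegP.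
exists ([seq (a * p.1, p.2) | p <- s] ++ t); split.
  by rewrite all_cat ti andbT all_map.
rewrite big_cat big_map scaler_sumr; congr (_ + _).
by apply: eq_bigr => p _; rewrite scale_tens.
Qed.

Lemma tdegD i (t u : tensor) : t \in tdeg i -> u \in tdeg i -> t + u \in tdeg i.
Proof.
by move=> ti ui; rewrite -[t]scale1r; case: (tdeg_submod i) => _; apply.
Qed.

Lemma tdeg_sum i (I : Type) (r : seq I) (P : pred I) (F : I -> tensor) :
  (forall j, P j -> F j \in tdeg i) -> \sum_(j <- r | P j) F j \in tdeg i.
Proof.
move=> H; elim/big_ind: _ => [|x y|j /H] //; last exact: tdegD.
by case: (tdeg_submod i).
Qed.

Fact tdeg_mul i j (t u : tensor) :
  t \in tdeg i -> u \in tdeg j -> t * u \in tdeg (i + j)%N.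
Proof.
move=> /tdegP[s [/allP si ->]] /tdegP[s' [/allP sj ->]].
rewrite mulr_suml big_seq; apply: tdeg_sum => p /si pi.
rewrite mulr_sumr big_seq; apply: tdeg_sum => q /sj qj.
by rewrite tensM tdeg_tens // gdeg_mul.
Qed.

Let tcomp_bal k : balanced (fun a (x : A) => tens a (gcomp k x)).
Proof.
split=> [a b x|a x y|a r x]; first exact: tensDl.
  by rewrite gcompD tensDr.
by rewrite gcompZ tensZ.
Qed.

Let tcomp k : tensor -> tensor := tens_lift (fun a (x : A) => tens a (gcomp k x)).

Let tcompD k : {morph tcomp k : t u / t + u}.
Proof. exact: tens_liftD (tcomp_bal k). Qed.

Let tcomp0 k : tcomp k 0 = 0.
Proof. exact: tens_lift0 (tcomp_bal k). Qed.

Let tcomp_sum k (I : Type) (r : seq I) (F : I -> tensor) :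
  tcomp k (\sum_(j <- r) F j) = \sum_(j <- r) tcomp k (F j).
Proof. exact: (big_morph _ (@tcompD k) (tcomp0 k)). Qed.

Let tcomp_id i k t : t \in tdeg i -> tcomp k t = if k == i then t else 0.
Proof.
move=> /tdegP[s [/allP si ->]]; rewrite tcomp_sum.
case: eqP => [->|/eqP/negPf ki]; [rewrite !big_seq|rewrite big_seq big1 //].
  apply: eq_bigr => p /si pi; rewrite /tcomp (tens_liftE (tcomp_bal _)).
  by rewrite (gcomp_id _ pi) eqxx.
move=> p /si pi; rewrite /tcomp (tens_liftE (tcomp_bal _)).
by rewrite (gcomp_id _ pi) ki tens0r.
Qed.

Fact tdeg_span (t : tensor) : exists n (a : nat -> tensor),
  (forall i, a i \in tdeg i) /\ t = \sum_(i < n) a i.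
Proof.
have tdeg0 i : 0 \in tdeg i by case: (tdeg_submod i).
elim/tensorW: t => [|a x t [n [u [un ->]]]].
  by exists 0%N, (fun => 0); rewrite big_ord0.
have [m xm] := gcomp_sum x.
pose v k := (if (k < m)%N then tens a (gcomp k x) else 0)
          + (if (k < n)%N then u k else 0).
exists (maxn m n), v; split=> [i|].
  apply: tdegD; case: ifP => _ //; apply: tdeg_tens; exact: gcomp_deg.
rewrite /v big_split -!big_mkcond /=.
have le1 : (m <= maxn m n)%N by rewrite leq_max leqnn.
have le2 : (n <= maxn m n)%N by rewrite leq_max leqnn orbT.
rewrite -(big_ord_widen _ (fun k => tens a (gcomp k x)) le1).
rewrite -(big_ord_widen _ u le2); congr (_ + _).
by rewrite {1}xm (big_morph (tens a) (tensDr a) (tens0r a)).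
Qed.

Fact tdeg_free n (a : nat -> tensor) : (forall i, a i \in tdeg i) ->
  \sum_(i < n) a i = 0 -> forall i, (i < n)%N -> a i = 0.
Proof.
move=> ain sum0 i iln; have := congr1 (tcomp i) sum0.
rewrite tcomp0 tcomp_sum (bigD1 (Ordinal iln)) //= (tcomp_id _ (ain i)) eqxx.
rewrite big1 ?addr0 // => j; rewrite -val_eqE /= => ji.
by rewrite (tcomp_id _ (ain j)) eq_sym (negPf ji).
Qed.

Fact tdeg0_inj : injective (fun a : S => a%:A : tensor).
Proof. by move=> a b /(congr1 taug); rewrite !alg_tens !taug_tens1. Qed.

Fact tdeg0P (t : tensor) : t \in tdeg 0 <-> exists a : S, t = a%:A.
Proof.
split=> [/tdegP[s [/allP s0 ->]]|[a ->]]; last first.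
  by rewrite alg_tens tdeg_tens // gdeg1.
elim: s s0 => [|[a x] s IH] s0; first by exists 0; rewrite big_nil scale0r.
have [|b eb] := IH; first by move=> p ps; apply: s0; rewrite inE ps orbT.
have /gdeg0P[r /= ->] := s0 (a, x) (mem_head _ _).
exists (a * f r + b); rewrite big_cons eb scalerDl; congr (_ + _).
by rewrite alg_tens tensZ.
Qed.

Definition base_change : gradedAlg S :=
  GradedAlg tdeg_submod tdeg_mul tdeg_span tdeg_free tdeg0_inj tdeg0P.

(* b |-> 1 (x) b *)
Definition tens1 (b : completion A) : completion base_change :=
  @Completion S base_change (fun i => tens 1 (b i))
    (fun i => tdeg_tens 1 (ccoefP b i)).

End Tensor.

Section HigherDerivations.
Variables (K : fieldType) (R : comAlgType K).

(* HD_K(R, B); B is a K-algebra through K -> R' -> B. *)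
Record higher_derivation (R' : comAlgType K) (f : {lrmorphism R -> R'})
    (B : gradedAlg R') := HigherDerivation {
  hd_map :> {rmorphism R -> completion B};
  hd_alg : forall c : K, hd_map c%:A = (c%:A : R')%:A;
  hd_aug : forall x, augmentation (hd_map x) = f x }.

Definition universal_hd (Om : gradedAlg R)
    (d : higher_derivation (idfun : {lrmorphism R -> R}) Om) : Prop :=
  forall (R' : comAlgType K),
    GRing.integral_domain_axiom R' -> fg_or_localisation R' ->
  forall (f : {lrmorphism R -> R'}) (B : gradedAlg R')
         (psi : higher_derivation f B),
  exists! psi' : completion (base_change f Om) -> completion B,
    cga_hom psi' /\ forall x, psi' (tens1 f (d x)) = psi x.

End HigherDerivations.

(* Main.v *)
(* The representing object is the Hasse-Schmidt algebra: the commutative       *)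
(* R-algebra generated by symbols d_n x (n : nat, x : R) subject to d_0 x = x,  *)
(* additivity, the Leibniz rules and d_n c = 0 for n > 0 and c in K.  Grading   *)
(* d_n x in degree n makes x |-> (d_n x)_n a higher derivation, and the         *)
(* relations are exactly those satisfied by the components of any higher        *)
(* derivation, whence universality.  Uniqueness is the usual argument: taking   *)
(* the identity of R as base change identifies R (x)_R Om with Om.              *)

Require Import Defs.
From HB Require Import structures.
From mathcomp Require Import all_boot all_order all_algebra.
From mathcomp Require Import boolp.

Set Implicit Arguments.
Unset Strict Implicit.
Unset Printing Implicit Defensive.

Import GRing.Theory.
Local Open Scope ring_scope.
Local Open Scope quotient_scope.

(** A higher derivation into a cga amounts to its components [D n], with values in the pieces [B_n],
    subject to additivity, the Leibniz rules, vanishing on [K] in positive degree, and a prescribed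
    [D 0]. These are polynomial identities, so a universal solution exists by generators and
    relations ([hs_alg_universal]). Two facts about this presentation need proof. [R] must embed in
    it as the degree 0 part, which follows by evaluating terms in a model ([hs_const_inj]) and
    reading a constant coefficient ([hs_poly_coef0]). It must also be the direct sum of its graded
    pieces: the coaction [hs_poly] splits an element into coefficients that are homogeneous
    ([hs_poly_coef_deg]) and sum to it ([hs_poly_horner1]). A higher derivation over [f] then gives
    an [f]-semilinear graded map, which extends uniquely along base change ([base_change_lift],
    [base_change_ext]) and degreewise to completions. Uniqueness is the Yoneda argument for base
    change along the identity ([universal_hd_endo]). *)

Section HasseSchmidtAlgebra.
Variables (K : fieldType) (R : comAlgType K).

(* HGen n x stands for d_n x. *)
Inductive hs_term :=
| HConst of R
| HGen of nat & R
| HAdd of hs_term & hs_term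
| HMul of hs_term & hs_term.

Implicit Types s t u : hs_term.

Definition hs_leibniz n (x y : R) : hs_term :=
  foldr HAdd (HConst 0)
    [seq HMul (HGen i x) (HGen (n - i) y) | i <- iota 0 n.+1].

(** The congruence generated by the commutative ring axioms, the requirement that constants come
    from a ring map on [R], and the laws of a higher derivation. Opposites are products with the
    constant -1, so terms need no negation. *)
Inductive hs_eq : hs_term -> hs_term -> Prop :=
| hsr_refl s : hs_eq s s
| hsr_sym s t : hs_eq s t -> hs_eq t s
| hsr_trans s t u : hs_eq s t -> hs_eq t u -> hs_eq s u
| hsr_congD s s' t t' : hs_eq s s' -> hs_eq t t' -> hs_eq (HAdd s t) (HAdd s' t')
| hsr_congM s s' t t' : hs_eq s s' -> hs_eq t t' -> hs_eq (HMul s t) (HMul s' t')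
| hsr_addA s t u : hs_eq (HAdd s (HAdd t u)) (HAdd (HAdd s t) u)
| hsr_addC s t : hs_eq (HAdd s t) (HAdd t s)
| hsr_add0 s : hs_eq (HAdd (HConst 0) s) s
| hsr_addN s : hs_eq (HAdd (HMul (HConst (-1)) s) s) (HConst 0)
| hsr_mulA s t u : hs_eq (HMul s (HMul t u)) (HMul (HMul s t) u)
| hsr_mulC s t : hs_eq (HMul s t) (HMul t s)
| hsr_mul1 s : hs_eq (HMul (HConst 1) s) s
| hsr_mulDl s t u : hs_eq (HMul (HAdd s t) u) (HAdd (HMul s u) (HMul t u))
| hsr_constD x y : hs_eq (HConst (x + y)) (HAdd (HConst x) (HConst y))
| hsr_constM x y : hs_eq (HConst (x * y)) (HMul (HConst x) (HConst y))
| hsr_gen0 x : hs_eq (HGen 0 x) (HConst x)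
| hsr_genD n x y : hs_eq (HGen n (x + y)) (HAdd (HGen n x) (HGen n y))
| hsr_genM n x y : hs_eq (HGen n (x * y)) (hs_leibniz n x y)
| hsr_genK n (c : K) : hs_eq (HGen n.+1 c%:A) (HConst 0).

(** * Evaluating terms in a commutative ring *)

Section Evaluation.
Variables (B : comNzRingType) (c : {rmorphism R -> B}) (D : nat -> R -> B).

(** Equivalently, [x] maps to the power series with coefficients [D n x], a ring homomorphism
    lifting [c] and constant on [K]. *)
Definition hs_family : Prop :=
  [/\ D 0 =1 c,
      forall n x y, D n (x + y) = D n x + D n y,
      forall n x y, D n (x * y) = \sum_(i < n.+1) D i x * D (n - i) y
    & forall n (a : K), D n.+1 a%:A = 0].

Fixpoint hs_eval (s : hs_term) : B :=
  match s with
  | HConst r => c r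
  | HGen n x => D n x
  | HAdd s t => hs_eval s + hs_eval t
  | HMul s t => hs_eval s * hs_eval t
  end.

Lemma hs_eval_leibniz n x y :
  hs_eval (hs_leibniz n x y) = \sum_(i < n.+1) D i x * D (n - i) y.
Proof.
rewrite /hs_leibniz -(big_mkord xpredT (fun i => D i x * D (n - i) y)).
rewrite /index_iota subn0; elim: (iota _ _) => [|i s IH] /=.
  by rewrite big_nil rmorph0.
by rewrite big_cons IH.
Qed.

Lemma hs_eval_eq s t : hs_family -> hs_eq s t -> hs_eval s = hs_eval t.
Proof.
case=> D0 DD DM DK; elim=> {s t} //=.
- by move=> ? ? ? _ -> _ ->.
- by move=> ? ? ? ? _ -> _ ->.
- by move=> ? ? ? ? _ -> _ ->.
- by move=> *; rewrite addrA.
- by move=> *; rewrite addrC.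
- by move=> *; rewrite rmorph0 add0r.
- by move=> *; rewrite rmorphN1 rmorph0 mulN1r addNr.
- by move=> *; rewrite mulrA.
- by move=> *; rewrite mulrC.
- by move=> *; rewrite rmorph1 mul1r.
- by move=> *; rewrite mulrDl.
- by move=> *; rewrite rmorphD.
- by move=> *; rewrite rmorphM.
- by move=> n x y; rewrite DM -hs_eval_leibniz.
- by move=> *; rewrite DK rmorph0.
Qed.

End Evaluation.

(** * The quotient as a commutative [R]-algebra *)

HB.instance Definition _ := gen_eqMixin hs_term.
HB.instance Definition _ := gen_choiceMixin hs_term.

Definition hs_rel s t := `[< hs_eq s t >].

Fact hs_rel_refl : reflexive hs_rel.
Proof. by move=> s; apply/asboolP; apply: hsr_refl. Qed.
Fact hs_rel_sym : symmetric hs_rel.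
Proof. by move=> s t; apply/asboolP/asboolP; apply: hsr_sym. Qed.
Fact hs_rel_trans : transitive hs_rel.
Proof.
by move=> s t u /asboolP e1 /asboolP e2; apply/asboolP; apply: hsr_trans e1 e2.
Qed.

Canonical hs_equiv := EquivRel hs_rel hs_rel_refl hs_rel_sym hs_rel_trans.

Definition hs_alg := {eq_quot hs_equiv}.
HB.instance Definition _ := Choice.on hs_alg.
HB.instance Definition _ := EqQuotient.on hs_alg.

Lemma hs_piP s t : hs_eq s t <-> \pi_hs_alg s = \pi_hs_alg t.
Proof.
split; first by move=> st; apply/eqquotP; apply/asboolP.
by move/eqquotP/asboolP.
Qed.

Lemma hs_reprP s : hs_eq (repr (\pi_hs_alg s)) s.
Proof. by apply/hs_piP; rewrite reprK. Qed.

Lemma hs_piW (P : hs_alg -> Prop) :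
  (forall s, P (\pi_hs_alg s)) -> forall a, P a.
Proof. by move=> H a; rewrite -[a]reprK. Qed.

Definition hs_const (r : R) : hs_alg := \pi_hs_alg (HConst r).
Definition hs_gen n (x : R) : hs_alg := \pi_hs_alg (HGen n x).
Definition hs_add (a b : hs_alg) : hs_alg := \pi_hs_alg (HAdd (repr a) (repr b)).
Definition hs_mul (a b : hs_alg) : hs_alg := \pi_hs_alg (HMul (repr a) (repr b)).
Definition hs_opp (a : hs_alg) : hs_alg := hs_mul (hs_const (-1)) a.

Lemma hs_add_pi s t :
  hs_add (\pi_hs_alg s) (\pi_hs_alg t) = \pi_hs_alg (HAdd s t).
Proof. by apply/hs_piP; apply: hsr_congD; apply: hs_reprP. Qed.

Lemma hs_mul_pi s t :
  hs_mul (\pi_hs_alg s) (\pi_hs_alg t) = \pi_hs_alg (HMul s t).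
Proof. by apply/hs_piP; apply: hsr_congM; apply: hs_reprP. Qed.

Fact hs_alg_addA : associative hs_add.
Proof.
elim/hs_piW=> s; elim/hs_piW=> t; elim/hs_piW=> u.
by rewrite !hs_add_pi; apply/hs_piP; apply: hsr_addA.
Qed.
Fact hs_alg_addC : commutative hs_add.
Proof.
elim/hs_piW=> s; elim/hs_piW=> t.
by rewrite !hs_add_pi; apply/hs_piP; apply: hsr_addC.
Qed.
Fact hs_alg_add0 : left_id (hs_const 0) hs_add.
Proof. by elim/hs_piW=> s; rewrite hs_add_pi; apply/hs_piP; apply: hsr_add0. Qed.
Fact hs_alg_addN : left_inverse (hs_const 0) hs_opp hs_add.
Proof.
elim/hs_piW=> s; rewrite /hs_opp hs_mul_pi hs_add_pi.
by apply/hs_piP; apply: hsr_addN.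
Qed.

HB.instance Definition _ :=
  GRing.isZmodule.Build hs_alg hs_alg_addA hs_alg_addC hs_alg_add0 hs_alg_addN.

Fact hs_alg_mulA : associative hs_mul.
Proof.
elim/hs_piW=> s; elim/hs_piW=> t; elim/hs_piW=> u.
by rewrite !hs_mul_pi; apply/hs_piP; apply: hsr_mulA.
Qed.
Fact hs_alg_mulC : commutative hs_mul.
Proof.
elim/hs_piW=> s; elim/hs_piW=> t.
by rewrite !hs_mul_pi; apply/hs_piP; apply: hsr_mulC.
Qed.
Fact hs_alg_mul1 : left_id (hs_const 1) hs_mul.
Proof. by elim/hs_piW=> s; rewrite hs_mul_pi; apply/hs_piP; apply: hsr_mul1. Qed.
Fact hs_alg_mulDl : left_distributive hs_mul +%R.
Proof.
elim/hs_piW=> s; elim/hs_piW=> t; elim/hs_piW=> u.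
rewrite [_ + _]hs_add_pi !hs_mul_pi [RHS]hs_add_pi.
by apply/hs_piP; apply: hsr_mulDl.
Qed.

(* Sending d_n x to 0 for n > 0 retracts the algebra onto R. *)
Let aug_family : hs_family idfun (fun n (x : R) => if n is 0%N then x else 0).
Proof.
split=> // [[|n] x y|[|n] x y]; rewrite ?addr0 //.
  by rewrite big_ord1.
by rewrite big_ord_recl subn0 mulr0 big1 ?addr0 // => i _; rewrite mul0r.
Qed.

(** Derivable equalities hold in every model; in the model [R] itself a constant evaluates to
    itself. *)
Lemma hs_const_inj : injective hs_const.
Proof. by move=> x y /hs_piP/(hs_eval_eq aug_family). Qed.

Fact hs_const1_neq0 : hs_const 1 != 0.
Proof. by apply/eqP => /hs_const_inj/eqP; rewrite oner_eq0. Qed.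

HB.instance Definition _ := GRing.Zmodule_isComNzRing.Build hs_alg
  hs_alg_mulA hs_alg_mulC hs_alg_mul1 hs_alg_mulDl hs_const1_neq0.

Lemma hs_piD s t : \pi_hs_alg (HAdd s t) = \pi_hs_alg s + \pi_hs_alg t.
Proof. by rewrite [RHS]hs_add_pi. Qed.

Lemma hs_piM s t : \pi_hs_alg (HMul s t) = \pi_hs_alg s * \pi_hs_alg t.
Proof. by rewrite [RHS]hs_mul_pi. Qed.

Lemma hs_constD x y : hs_const (x + y) = hs_const x + hs_const y.
Proof. by rewrite -hs_piD; apply/hs_piP; apply: hsr_constD. Qed.

Lemma hs_constM x y : hs_const (x * y) = hs_const x * hs_const y.
Proof. by rewrite -hs_piM; apply/hs_piP; apply: hsr_constM. Qed.

Lemma hs_const0 : hs_const 0 = 0. Proof. by []. Qed.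
Lemma hs_const1 : hs_const 1 = 1. Proof. by []. Qed.

HB.instance Definition _ := GRing.isNmodMorphism.Build R hs_alg hs_const
  (conj hs_const0 hs_constD).
HB.instance Definition _ := GRing.isMonoidMorphism.Build R hs_alg hs_const
  (conj hs_const1 hs_constM).

Definition hs_scale (r : R) (a : hs_alg) : hs_alg := hs_const r * a.

Fact hs_scaleA r r' a : hs_scale r (hs_scale r' a) = hs_scale (r * r') a.
Proof. by rewrite /hs_scale mulrA rmorphM. Qed.
Fact hs_scale1 : left_id 1 hs_scale.
Proof. by move=> a; rewrite /hs_scale rmorph1 mul1r. Qed.
Fact hs_scaleDr : right_distributive hs_scale +%R.
Proof. by move=> r a b; rewrite /hs_scale mulrDr. Qed.
Fact hs_scaleDl a : {morph hs_scale^~ a : r s / r + s}.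
Proof. by move=> r s; rewrite /hs_scale rmorphD mulrDl. Qed.

HB.instance Definition _ := GRing.Zmodule_isLmodule.Build R hs_alg
  hs_scaleA hs_scale1 hs_scaleDr hs_scaleDl.

Fact hs_scaleAl (r : R) (a b : hs_alg) : r *: (a * b) = (r *: a) * b.
Proof. exact: mulrA. Qed.

HB.instance Definition _ := GRing.Lmodule_isLalgebra.Build R hs_alg hs_scaleAl.
HB.instance Definition _ := GRing.Lalgebra_isComAlgebra.Build R hs_alg.

Lemma hs_scaleE (r : R) (a : hs_alg) : r *: a = hs_const r * a.
Proof. by []. Qed.

Lemma hs_algE (r : R) : r%:A = hs_const r.
Proof. by rewrite hs_scaleE mulr1. Qed.

(** * The generic family and its universal property *)

Lemma hs_gen_family : hs_family hs_const hs_gen.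
Proof.
split=> [x|n x y|n x y|n a].
- by apply/hs_piP; apply: hsr_gen0.
- by rewrite -hs_piD; apply/hs_piP; apply: hsr_genD.
- have -> : hs_gen n (x * y) = \pi_hs_alg (hs_leibniz n x y).
    by apply/hs_piP; apply: hsr_genM.
  (* Evaluating any term at the generic family returns its own class; induction on the term turns
     the formal Leibniz sum into an actual one. *)
  rewrite -(hs_eval_leibniz (hs_const : {rmorphism R -> hs_alg})); elim: (hs_leibniz n x y) => //= s IHs t IHt.
    by rewrite hs_piD IHs IHt.
  by rewrite hs_piM IHs IHt.
- by apply/hs_piP; apply: hsr_genK.
Qed.

Lemma hs_algW (P : hs_alg -> Prop) :
    (forall r, P (hs_const r)) -> (forall n x, P (hs_gen n x)) ->
    (forall a b, P a -> P b -> P (a + b)) ->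
    (forall a b, P a -> P b -> P (a * b)) ->
  forall a, P a.
Proof.
move=> Pc Pg PD PM; elim/hs_piW; elim=> // s Ps t Pt.
  by rewrite hs_piD; apply: PD.
by rewrite hs_piM; apply: PM.
Qed.

Lemma hs_alg_universal (B : comNzRingType) (c : {rmorphism R -> B})
    (D : nat -> R -> B) : hs_family c D ->
  exists h : {rmorphism hs_alg -> B},
    (forall r, h (hs_const r) = c r) /\ (forall n x, h (hs_gen n x) = D n x).
Proof.
move=> cD; pose h (a : hs_alg) := hs_eval c D (repr a).
have hE s : h (\pi_hs_alg s) = hs_eval c D s.
  by apply: hs_eval_eq => //; apply: hs_reprP.
have hD : nmod_morphism h.
  split; first by rewrite [LHS](hE (HConst 0)) /= rmorph0.
  by elim/hs_piW=> s; elim/hs_piW=> t; rewrite -hs_piD !hE.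
have hM : monoid_morphism h.
  split; first by rewrite [LHS](hE (HConst 1)) /= rmorph1.
  by elim/hs_piW=> s; elim/hs_piW=> t; rewrite -hs_piM !hE.
pose H : {rmorphism hs_alg -> B} := HB.pack h
  (GRing.isNmodMorphism.Build _ _ h hD) (GRing.isMonoidMorphism.Build _ _ h hM).
by exists H; split=> *; rewrite /H /= hE.
Qed.

(** * The grading, from a coaction *)

Lemma hs_gen_poly_family :
  hs_family (polyC \o hs_const : {rmorphism R -> {poly hs_alg}})
            (fun n x => hs_gen n x *: 'X^n).
Proof.
have [g0 gD gM gK] := hs_gen_family.
split=> [x|n x y|n x y|n a].
- by rewrite g0 expr0 alg_polyC.
- by rewrite gD scalerDl.
(* The Leibniz rule is homogeneous: the weights [i] and [n - i] add up to [n]. *)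
- rewrite gM scaler_suml; apply: eq_bigr => i _.
  by rewrite -scalerAl -scalerAr scalerA -exprD subnKC // -ltnS.
- by rewrite gK scale0r.
Qed.

(* The coaction d_n x |-> d_n x X^n of the multiplicative group; the elements  *)
(* of degree i are those sent to a X^i.                                        *)
Definition hs_poly : {rmorphism hs_alg -> {poly hs_alg}} :=
  sval (cid (hs_alg_universal hs_gen_poly_family)).

Lemma hs_poly_const r : hs_poly (hs_const r) = (hs_const r)%:P.
Proof. by rewrite /hs_poly; case: cid => h [? ?]. Qed.

Lemma hs_poly_gen n x : hs_poly (hs_gen n x) = hs_gen n x *: 'X^n.
Proof. by rewrite /hs_poly; case: cid => h [? ?]. Qed.

Definition hs_deg i : {pred hs_alg} := fun a => hs_poly a == a *: 'X^i.

Lemma hs_degP i a : reflect (hs_poly a = a *: 'X^i) (a \in hs_deg i).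
Proof. exact: eqP. Qed.

Lemma hs_deg_const r : hs_const r \in hs_deg 0.
Proof. by apply/hs_degP; rewrite hs_poly_const expr0 alg_polyC. Qed.

Lemma hs_deg_gen n x : hs_gen n x \in hs_deg n.
Proof. by apply/hs_degP; rewrite hs_poly_gen. Qed.

Fact hs_deg_mul i j a b :
  a \in hs_deg i -> b \in hs_deg j -> a * b \in hs_deg (i + j)%N.
Proof.
move=> /hs_degP ai /hs_degP bj; apply/hs_degP.
by rewrite rmorphM ai bj -scalerAl -scalerAr scalerA exprD.
Qed.

Fact hs_deg_submod i : GRing.submod_closed (hs_deg i).
Proof.
split; first by apply/hs_degP; rewrite rmorph0 scale0r.
move=> r a b ai /hs_degP bi; apply/hs_degP.
have /hs_degP rai := hs_deg_mul (hs_deg_const r) ai.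
by rewrite hs_scaleE rmorphD rai bi scalerDl.
Qed.

Lemma hs_deg0 i : 0 \in hs_deg i.
Proof. by case: (hs_deg_submod i). Qed.

Lemma hs_degD i a b : a \in hs_deg i -> b \in hs_deg i -> a + b \in hs_deg i.
Proof.
by move=> ai bi; rewrite -[a]scale1r; case: (hs_deg_submod i) => _; apply.
Qed.

(** Coassociativity of the coaction: it holds on constants and generators and passes to sums and, by
    convolution of coefficients, to products. *)
Lemma hs_poly_coef_deg a i : (hs_poly a)`_i \in hs_deg i.
Proof.
move: a i; apply: hs_algW => [r|n x|a b Ha Hb|a b Ha Hb] i.
- rewrite hs_poly_const coefC; case: eqP => [->|_]; last exact: hs_deg0.
  exact: hs_deg_const.
- rewrite hs_poly_gen coefZ coefXn; case: eqP => [->|_].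
    by rewrite mulr1 hs_deg_gen.
  by rewrite mulr0 hs_deg0.
- by rewrite rmorphD coefD hs_degD.
- rewrite rmorphM coefM; elim/big_ind: _ => [|x y|j _]; first exact: hs_deg0.
    exact: hs_degD.
  by have := hs_deg_mul (Ha j) (Hb (i - j)%N); rewrite subnKC // -ltnS.
Qed.

(** The counit law: at [X = 1] every weight becomes trivial. Hence an element is the sum of its
    coefficients. *)
Lemma hs_poly_horner1 a : (hs_poly a).[1] = a.
Proof.
elim/hs_algW: a => [r|n x|a b Ha Hb|a b Ha Hb].
- by rewrite hs_poly_const hornerC.
- by rewrite hs_poly_gen hornerZ hornerXn expr1n mulr1.
- by rewrite rmorphD hornerD Ha Hb.
- by rewrite rmorphM hornerM Ha Hb.
Qed.

Lemma hs_poly_coef0 a : exists r, (hs_poly a)`_0 = hs_const r.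
Proof.
elim/hs_algW: a => [r|n x|a b [r Ha] [r' Hb]|a b [r Ha] [r' Hb]].
- by exists r; rewrite hs_poly_const coefC.
- rewrite hs_poly_gen coefZ coefXn; case: n => [|n].
    by exists x; rewrite mulr1; case: hs_gen_family.
  by exists 0; rewrite mulr0.
- by exists (r + r'); rewrite rmorphD coefD Ha Hb hs_constD.
- by exists (r * r'); rewrite rmorphM coef0M Ha Hb hs_constM.
Qed.

Fact hs_deg_span a : exists n (u : nat -> hs_alg),
  (forall i, u i \in hs_deg i) /\ a = \sum_(i < n) u i.
Proof.
exists (size (hs_poly a)), (fun i => (hs_poly a)`_i).
split; first exact: hs_poly_coef_deg.
rewrite -[LHS]hs_poly_horner1 horner_coef; apply: eq_bigr => i _.
by rewrite expr1n mulr1.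
Qed.

Fact hs_deg_free n (u : nat -> hs_alg) : (forall i, u i \in hs_deg i) ->
  \sum_(i < n) u i = 0 -> forall i, (i < n)%N -> u i = 0.
Proof.
(* The coaction separates the summands into distinct powers of [X]. *)
move=> uin /(congr1 hs_poly); rewrite rmorph0 rmorph_sum /=.
under eq_bigr => i _ do rewrite (hs_degP _ _ (uin i)).
rewrite -poly_def => u0 i iltn.
by have := congr1 (fun p : {poly hs_alg} => p`_i) u0; rewrite coef_poly iltn coef0.
Qed.

Fact hs_alg_inj : injective (fun r : R => r%:A : hs_alg).
Proof. by move=> x y; rewrite !hs_algE => /hs_const_inj. Qed.

Fact hs_deg0P a : a \in hs_deg 0 <-> exists r : R, a = r%:A.
Proof.
split=> [/hs_degP a0|[r ->]]; last by rewrite hs_algE hs_deg_const.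
have [r] := hs_poly_coef0 a; rewrite a0 expr0 alg_polyC coefC /= => ar.
by exists r; rewrite hs_algE.
Qed.

Definition hs_graded : gradedAlg R :=
  GradedAlg hs_deg_submod hs_deg_mul hs_deg_span hs_deg_free hs_alg_inj hs_deg0P.

(** * The universal higher derivation *)

Definition hs_der (x : R) : completion hs_graded :=
  @Completion R hs_graded (fun n => hs_gen n x) (fun n => hs_deg_gen n x).

Lemma hs_der_alg (a : K) : hs_der a%:A = (a%:A : R)%:A.
Proof.
have [g0 _ _ gK] := hs_gen_family; apply: completion_eq => -[|n].
  by rewrite [LHS]g0 [RHS]hs_algE.
by rewrite [LHS]gK [RHS]scaler0.
Qed.

Fact hs_der_nmod : nmod_morphism hs_der.
Proof.
have [g0 gD _ gK] := hs_gen_family; split=> [|x y]; apply: completion_eq.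
  case=> [|n]; first by rewrite [LHS]g0.
  (* Zero lies in the image of [K], so its positive components vanish by [gK]. *)
  by rewrite -[0](scale0r (1 : R)) [LHS]gK.
by move=> n; rewrite [LHS]gD.
Qed.

Fact hs_der_monoid : monoid_morphism hs_der.
Proof.
split; first by rewrite -[in LHS](scale1r (1 : R)) hs_der_alg !scale1r.
by move=> x y; apply: completion_eq => n; case: hs_gen_family => _ _ + _; apply.
Qed.

HB.instance Definition _ :=
  GRing.isNmodMorphism.Build R (completion hs_graded) hs_der hs_der_nmod.
HB.instance Definition _ :=
  GRing.isMonoidMorphism.Build R (completion hs_graded) hs_der hs_der_monoid.

Lemma hs_der_aug x :
  augmentation (hs_der x) = (idfun : {lrmorphism R -> R}) x.
Proof.
apply: (@gdeg0_inj _ hs_graded); rewrite augmentationE hs_algE.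
by case: hs_gen_family => + _ _ _; apply.
Qed.

Definition hs_hd :
    higher_derivation (idfun : {lrmorphism R -> R}) hs_graded :=
  HigherDerivation hs_der_alg hs_der_aug.

End HasseSchmidtAlgebra.

(** * Graded maps out of a base change *)

Section BaseChange.
Variables (R S : comNzRingType) (f : {rmorphism R -> S}) (A : gradedAlg R).
Variable B : gradedAlg S.

(** Extension of scalars is left adjoint to restriction, here for graded algebras. *)
Lemma base_change_lift (h : {rmorphism A -> B}) :
    (forall r x, h (r *: x) = f r *: h x) ->
    (forall i x, x \in gdeg A i -> h x \in gdeg B i) ->
  exists g : {lrmorphism base_change f A -> B},
    graded_hom g /\ forall a x, g (tens f a x) = a *: h x.
Proof.
move=> hZ hdeg; pose phi a x : B := a *: h x.
have phiP : balanced f phi.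
  split=> [a b x|a x y|a r x]; first exact: scalerDl.
    by rewrite /phi rmorphD scalerDr.
  by rewrite /phi hZ scalerA.
pose g : base_change f A -> B := tens_lift phi.
have gE a x : g (tens f a x) = a *: h x by apply: tens_liftE.
have g0 : g 0 = 0 by apply: tens_lift0.
have gD : {morph g : t u / t + u} by apply: tens_liftD.
have gZ : scalable g.
  move=> a; elim/tensorW=> [|b x t IH]; first by rewrite scaler0 g0 scaler0.
  by rewrite scalerDr !gD IH scale_tens !gE scalerDr scalerA.
have gM : monoid_morphism g.
  split; first by rewrite [LHS](gE 1 1) rmorph1 scale1r.
  elim/tensorW=> [|a x t IHt] u; first by rewrite mul0r g0 mul0r.
  rewrite mulrDl !gD IHt mulrDl; congr (_ + _).
  elim/tensorW: u => [|b y u IHu]; first by rewrite mulr0 g0 mulr0.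
  rewrite mulrDr !gD IHu mulrDr tensM !gE rmorphM; congr (_ + _).
  by rewrite -scalerAl -scalerAr scalerA.
pose G : {lrmorphism base_change f A -> B} := HB.pack g
  (GRing.isNmodMorphism.Build _ _ g (conj g0 gD))
  (GRing.isMonoidMorphism.Build _ _ g gM)
  (GRing.isScalable.Build _ _ _ _ g gZ).
exists G; split=> // i t /tdegP[s [/allP si ->]].
rewrite rmorph_sum big_seq; apply: gdeg_sum => p /si pi.
by rewrite /= gE gdegZ // hdeg.
Qed.

Lemma base_change_ext (g g' : {lrmorphism base_change f A -> B}) :
  (forall x, g (tens f 1 x) = g' (tens f 1 x)) -> g =1 g'.
Proof.
move=> gg'; elim/tensorW=> [|a x t IH]; first by rewrite !rmorph0.
rewrite !rmorphD; congr (_ + _); last exact: IH.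
by rewrite -[a]mulr1 -scale_tens [LHS]linearZ [RHS]linearZ /= gg'.
Qed.

End BaseChange.

(** * Maps of completions, and universality *)

Lemma cga_hom_of_graded (S : comNzRingType) (A B : gradedAlg S)
    (g : {lrmorphism A -> B}) : graded_hom g ->
  exists phi : completion A -> completion B,
    cga_hom phi /\ forall b i, phi b i = g (b i).
Proof.
move=> gdg; pose phi (b : completion A) : completion B :=
  Completion (fun i => gdg i _ (ccoefP b i)).
by exists phi; split=> //; exists g.
Qed.

Lemma cga_hom_comp (S : comNzRingType) (A B C : gradedAlg S)
    (phi : completion A -> completion B) (psi : completion B -> completion C) :
  cga_hom phi -> cga_hom psi -> cga_hom (psi \o phi).
Proof.
move=> [g [gdg gE]] [h [hdg hE]].
exists (h \o g : {lrmorphism A -> C}); split=> [i x xi|b i] /=.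
  exact/hdg/gdg.
by rewrite hE gE.
Qed.

Lemma hs_hd_universal (K : fieldType) (R : comAlgType K) :
  universal_hd (hs_hd R).
Proof.
move=> R' _ _ f B psi.
have psiP : hs_family (in_alg B \o f : {rmorphism R -> B}) (fun n x => psi x n).
  split=> [x|n x y|n x y|n a].
  - by rewrite -augmentationE hd_aug.
  - by rewrite rmorphD.
  - by rewrite rmorphM.
  - by rewrite hd_alg [LHS]scaler0.
have [h [hc hg]] := hs_alg_universal psiP.
have hZ (r : R) (x : hs_graded R) : h (r *: x) = f r *: h x.
  by rewrite hs_scaleE rmorphM hc mulr_algl.
(* Induction over generators leaves the homogeneous elements, so degree preservation is proved for
   the coefficients of the coaction on arbitrary elements; a homogeneous element is its own
   coefficient. *)
have hcoef a : forall i, h (hs_poly R a)`_i \in gdeg B i.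
  elim/hs_algW: a => [r|n x|a b Ha Hb|a b Ha Hb] i.
  - rewrite hs_poly_const coefC; case: eqP => [->|_].
      by rewrite hc gdegZ // gdeg1.
    by rewrite rmorph0 gdeg0r.
  - rewrite hs_poly_gen coefZ coefXn; case: eqP => [->|_].
      by rewrite mulr1 hg ccoefP.
    by rewrite mulr0 rmorph0 gdeg0r.
  - by rewrite rmorphD coefD rmorphD gdegD.
  - rewrite rmorphM coefM rmorph_sum; apply: gdeg_sum => j _.
    have := gdeg_mul (Ha j) (Hb (i - j)%N).
    by rewrite -rmorphM subnKC // -ltnS.
have hdeg i x : x \in gdeg (hs_graded R) i -> h x \in gdeg B i.
  by move=> /hs_degP xi; have := hcoef x i; rewrite xi coefZ coefXn eqxx mulr1.
have [g [gdg gE]] := base_change_lift hZ hdeg.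
have [phi [homphi phiE]] := cga_hom_of_graded gdg.
exists phi; split.
  by split=> // x; apply: completion_eq => n; rewrite phiE [LHS]gE scale1r hg.
(* A competitor comes from some graded [g'], which is determined by its values on [1 (x) a].
   Linearity settles constants, and component [n] of [phi'd] settles [d_n x]. *)
move=> phi' [[g' [_ g'E]] phi'd]; apply/funext => b; apply: completion_eq => i.
rewrite phiE g'E; apply: base_change_ext => {b i} a.
elim/hs_algW: a => [r|n x|a b Ha Hb|a b Ha Hb].
- rewrite -hs_algE -tensZ -[1 * f r]mulrC -scale_tens.
  by rewrite [LHS]linearZ [RHS]linearZ !rmorph1.
- have := congr1 (fun b : completion B => b n) (phi'd x).
  by rewrite /= g'E => ->; rewrite gE scale1r hg.
- by rewrite tensDr [LHS]rmorphD [RHS]rmorphD; congr (_ + _).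
- by rewrite -[1]mulr1 -tensM [LHS]rmorphM [RHS]rmorphM; congr (_ * _).
Qed.

(** * Uniqueness of the representing object *)

Section Uniqueness.
Variables (K : fieldType) (R : comAlgType K).
Local Notation idR := (idfun : {lrmorphism R -> R}).
Implicit Types Om : gradedAlg R.

Lemma tens1_id_cga_hom Om : cga_hom (@tens1 R R idR Om).
Proof.
pose j : Om -> base_change idR Om := tens idR 1.
have jD : nmod_morphism j.
  by split=> [|x y]; [apply: tens0r | apply: tensDr].
have jM : monoid_morphism j.
  by split=> // x y; rewrite [RHS]tensM mulr1.
have jZ : scalable j.
  by move=> r x; rewrite [RHS]scale_tens mulr1 -[r]mul1r [RHS]tensZ mul1r.
pose J : {lrmorphism Om -> base_change idR Om} := HB.pack j
  (GRing.isNmodMorphism.Build _ _ j jD) (GRing.isMonoidMorphism.Build _ _ j jM)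
  (GRing.isScalable.Build _ _ _ _ j jZ).
by exists J; split=> // i x xi; apply: tdeg_tens.
Qed.

(** The universal property concerns maps out of the base change; this retraction brings
    endomorphisms of [Om] into its scope. *)
Lemma tens1_id_retract Om :
  exists q : completion (base_change idR Om) -> completion Om,
    cga_hom q /\ forall b, q (tens1 idR b) = b.
Proof.
have [||g [gdg gE]] := @base_change_lift R R idR Om Om idfun => //.
have [q [qhom qE]] := cga_hom_of_graded gdg.
exists q; split=> // b; apply: completion_eq => i.
by rewrite qE [LHS]gE scale1r.
Qed.

Hypotheses (domR : GRing.integral_domain_axiom R) (fgR : fg_or_localisation R).

Lemma universal_hd_factor Om Om' (d : higher_derivation idR Om)
    (d' : higher_derivation idR Om') : universal_hd d ->
  exists phi : completion Om -> completion Om',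
    cga_hom phi /\ forall x, phi (d x) = d' x.
Proof.
move=> /(_ R domR fgR idR Om' d')[p [[phom pd] _]].
exists (p \o tens1 idR (A := Om)); split=> //.
exact: cga_hom_comp (tens1_id_cga_hom Om) phom.
Qed.

(** Both [q] and [phi \o q] send [1 (x) d x] to [d x], so they agree by universality; composing with
    [tens1] removes [q]. *)
Lemma universal_hd_endo Om (d : higher_derivation idR Om)
    (phi : completion Om -> completion Om) :
  universal_hd d -> cga_hom phi -> (forall x, phi (d x) = d x) -> phi =1 id.
Proof.
move=> /(_ R domR fgR idR Om d)[p [_ puniq]] homphi phid b.
have [q [qhom qE]] := tens1_id_retract Om.
have pq : p = q by apply: puniq; split=> // x; rewrite qE.
have pphiq : p = phi \o q.
  by apply: puniq; split=> [|x] /=; [exact: cga_hom_comp | rewrite qE].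
by rewrite -[in LHS](qE b) -[LHS]/((phi \o q) _) -pphiq pq qE.
Qed.

End Uniqueness.

Theorem theorem3p10 (K : fieldType) (perfK : perfect_field K)
    (R : comAlgType K) (domR : GRing.integral_domain_axiom R)
    (fgR : fg_or_localisation R) :
  (exists (Om : gradedAlg R)
          (d : higher_derivation (idfun : {lrmorphism R -> R}) Om),
     universal_hd d) /\
  (forall (Om Om' : gradedAlg R)
          (d : higher_derivation (idfun : {lrmorphism R -> R}) Om)
          (d' : higher_derivation (idfun : {lrmorphism R -> R}) Om'),
     universal_hd d -> universal_hd d' ->
     exists phi : completion Om -> completion Om',
       cga_iso phi /\ forall x, phi (d x) = d' x).
Proof.
split; first by exists (hs_graded R), (hs_hd R); apply: hs_hd_universal.
move=> Om Om' d d' dU d'U.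
have [phi [phihom phid]] := universal_hd_factor domR fgR d' dU.
have [psi [psihom psid']] := universal_hd_factor domR fgR d d'U.
exists phi; split=> //; split=> //; exists psi; split=> //.
- apply: (universal_hd_endo domR fgR dU); first exact: cga_hom_comp phihom psihom.
  by move=> x /=; rewrite phid.
- apply: (universal_hd_endo domR fgR d'U); first exact: cga_hom_comp psihom phihom.
  by move=> x /=; rewrite psid'.
Qed.
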